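(* Let $X_1,\dots,X_n$ be Polish spaces, $1\le k<n$, let $\{\mu_\alpha\}_{\alpha\in\mathcal{I}_{nk}}$, $\mu_\alpha\in\mathcal{P}(X_\alpha)$, be a reducible family, and let $c:X\to[-\infty,+\infty]$ be Borel measurable. Suppose there exist integrable functions $c_\alpha:X_\alpha\to(-\infty,+\infty]$, $c_\alpha\in L^1(\mu_\alpha)$, with $|c(x)|\le\sum_{\alpha\in\mathcal{I}_{nk}}c_\alpha(x_\alpha)$ for all $x\in X$. Then $$J=\sup\Big\{\sum_{\alpha\in\mathcal{I}_{nk}}\int_{X_\alpha}f_\alpha\,d\mu_\alpha:\ \{f_\alpha\}\in\Psi_c(\mu_\alpha)\Big\}$$ is finite and attained by some $\{f_\alpha\}\in\Psi_c(\mu_\alpha)$.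
   Context: $X=\prod_iX_i$; $\mathcal{I}_{nk}$ is the family of $k$-element subsets of $\{1,\dots,n\}$; $X_\alpha=\prod_{i\in\alpha}X_i$, $\mathrm{Pr}_\alpha$ the projection, $x_\alpha=\mathrm{Pr}_\alpha(x)$. Two measures are uniformly equivalent if one has a density with respect to the other bounded above and below by positive constants. The family $\{\mu_\alpha\}$ is reducible if there is a probability measure $\mu$ on $X$ with $\mathrm{Pr}_\alpha(\mu)=\mu_\alpha$ for all $\alpha\in\mathcal{I}_{nk}$ that is uniformly equivalent to $\prod_i\nu_i$ for some $\nu_i\in\mathcal{P}(X_i)$. A measurable set $A\subseteq X$ has zero $(n,k)$-thickness if there are measurable $Y_\alpha\subseteq X_\alpha$ with $\mu_\alpha(Y_\alpha)=0$ and $A\subseteq\bigcup_\alpha\mathrm{Pr}_\alpha^{-1}(Y_\alpha)$. $\Psi_c(\mu_\alpha)$ is the set of tuples $\{f_\alpha\}_{\alpha\in\mathcal{I}_{nk}}$ of real-valued functions $f_\alpha\in L^1(X_\alpha,\mu_\alpha)$ such that $\sum_\alpha f_\alpha(x_\alpha)\le c(x)$ for all $x\in X$ outside a set of zero $(n,k)$-thickness (relaxed dual problem). *)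

(* Defs.v *)
From HB Require Import structures.
From mathcomp Require Import all_boot all_order all_algebra.
From mathcomp Require Import all_classical all_reals all_analysis.
From mathcomp Require Import measurable_realfun.
Import Order.TTheory GRing.Theory Num.Theory.
Unset Printing Implicit Defensive.
Local Open Scope classical_set_scope.
Local Open Scope ring_scope.

Definition polish (R : realType) (T : topologicalType) : Prop :=
  (exists D : set T, countable D /\ closure D = setT) /\
  exists d : T -> T -> R,
    (forall x y, 0 <= d x y) /\
    (forall x y, d x y = 0 <-> x = y) /\
    (forall x y, d x y = d y x) /\
    (forall x y z, d x z <= d x y + d y z) /\
    (forall A : set T, open A <->
        (forall x, A x -> exists e : R, 0 < e /\ [set y | d x y < e] `<=` A)) /\
    (forall u : nat -> T,
       (forall e : R, 0 < e -> exists N, forall m p, (N <= m)%N -> (N <= p)%N ->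
           d (u m) (u p) < e) ->
       exists l, forall e : R, 0 < e -> exists N, forall m, (N <= m)%N -> d (u m) l < e).

Section Spaces.
Variables (n : nat) (X : 'I_n -> ptopologicalType).

Definition borelX (i : 'I_n) := g_sigma_algebraType (@open (X i)).
HB.instance Definition _ (i : 'I_n) := Measurable.on (borelX i).

Definition cylA (a : {set 'I_n}) :
    set (set (forall i : {i : 'I_n | i \in a}, X (val i))) :=
  [set A | exists i, exists B : set (X (val i)),
     <<s @open (X (val i)) >> B /\ A = (fun y => y i) @^-1` B].

Definition XA (a : {set 'I_n}) := g_sigma_algebraType (cylA a).
HB.instance Definition _ (a : {set 'I_n}) := Measurable.on (XA a).

Definition cylX : set (set (forall i : 'I_n, X i)) :=
  [set A | exists i, exists B : set (X i),
     <<s @open (X i) >> B /\ A = (fun x => x i) @^-1` B].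

Definition XX := g_sigma_algebraType cylX.
HB.instance Definition _ := Measurable.on XX.

Definition Pr (a : {set 'I_n}) (x : XX) : XA a := fun i => x (val i).

End Spaces.
Arguments borelX {n} X i.
Arguments cylA {n} X a.
Arguments XA {n} X a.
Arguments cylX {n} X.
Arguments XX {n} X.
Arguments Pr {n} X a x.

Section Problem.
Variables (R : realType) (n k : nat) (X : 'I_n -> ptopologicalType)
  (mu : forall a : {set 'I_n}, probability (XA X a) R).

Definition is_product_measure (nu : forall i, probability (borelX X i) R)
    (P : probability (XX X) R) : Prop :=
  forall A : forall i, set (X i),
    (forall i, measurable (A i : set (borelX X i))) ->
    P [set x : XX X | forall i, A i (x i)] = (\prod_(i < n) nu i (A i))%E.

Definition unif_equiv (mu1 mu2 : probability (XX X) R) : Prop :=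
  exists rho : XX X -> R, measurable_fun setT rho /\
  exists a b : R, 0 < a /\ (forall x, a <= rho x <= b) /\
    forall A, measurable A -> mu1 A = (\int[mu2]_(x in A) (rho x)%:E)%E.

Definition reducible : Prop :=
  exists muX : probability (XX X) R,
    (forall a : {set 'I_n}, #|a| = k ->
       forall A, measurable A -> muX (Pr X a @^-1` A) = mu a A) /\
    exists nu : forall i, probability (borelX X i) R,
    exists P : probability (XX X) R,
      is_product_measure nu P /\ unif_equiv muX P.

Definition zero_thick (A : set (XX X)) : Prop :=
  measurable A /\
  exists Y : forall a : {set 'I_n}, set (XA X a),
    (forall a : {set 'I_n}, #|a| = k -> measurable (Y a) /\ mu a (Y a) = 0%E) /\
    A `<=` \bigcup_(a in [set a : {set 'I_n} | #|a| = k]) (Pr X a @^-1` Y a).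

Definition Psi (c : XX X -> \bar R) (f : forall a : {set 'I_n}, XA X a -> R) : Prop :=
  (forall a : {set 'I_n}, #|a| = k ->
     measurable_fun setT (f a) /\ (mu a).-integrable setT (EFin \o f a)) /\
  exists A, zero_thick A /\
    forall x, ~ A x ->
      ((\sum_(a : {set 'I_n} | #|a| == k) f a (Pr X a x))%:E <= c x)%E.

Definition dual_value (f : forall a : {set 'I_n}, XA X a -> R) : \bar R :=
  (\sum_(a : {set 'I_n} | #|a| == k) \int[mu a]_x (f a x)%:E)%E.

Definition Jval (c : XX X -> \bar R) : \bar R :=
  ereal_sup [set v | exists f, Psi c f /\ v = dual_value f].

End Problem.

(* Main.v *)
Require Import Defs.
From HB Require Import structures.
From mathcomp Require Import all_boot all_order all_algebra.
From mathcomp Require Import all_classical all_reals all_analysis.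
From mathcomp Require Import measurable_realfun.
From mathcomp Require Import ring lra.
Import Order.TTheory GRing.Theory Num.Theory.
Import numFieldNormedType.Exports.
Local Open Scope classical_set_scope.
Local Open Scope ring_scope.

(** A maximizing sequence must converge off a thin set, not just almost everywhere.
    Let [pi] be the reference measure, equivalent to a product [P], and write
    [G f = \sum_a (f_a - c_a) <= 0].

    - Among nearly optimal tuples, nearly minimize [\int exp (G f) dpi].  Convexity
      of [exp] makes [exp (G_j / 2)] converge almost everywhere, and by Fatou the
      limit is positive, so that [G_j] itself converges to an integrable [L].  All
      this is controlled by one integrable [S]: [G_j x] converges whenever
      [S x < +oo].
    - Let [mix d x y] agree with [x] on [d] and with [y] off [d].  A sum of functions
      of [k] coordinates satisfies, at every point,
        [G x = \sum_(#|b| <= k) \sum_(d \subset b) (-1)^(#|b| + #|d|) G (mix d x y)],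
      and [mix d] maps [P \x P] to [P].  By Fubini some [y] makes all the functions
      [S (mix d . y)] integrable; grouping the terms above by a [k]-set containing [b]
      then gives new components which converge outside null sets of [X_a], and the
      inequality with [c] passes to the limit.
    - Optimality of the limit is the reverse Fatou inequality. *)

(** * Convergence of real sequences through their exponentials *)

(** Summability makes [expR (g j / 2)] converge to some [v >= 0]. If [v = 0], then [g] tends to
    [-oo] and the lower limit of [|g j|] is infinite; so [v > 0] and [g] tends to [2 * ln v]. *)
Lemma cvg_of_expR_bounded_variation {R : realType} (g : R^nat) :
  (\sum_(0 <= j <oo)
     `|expR (g j.+1 / 2) - expR (g j / 2)|%:E < +oo)%E ->
  (limn_einf (fun j => `|g j|%:E) < +oo)%E ->
  exists2 l, g @ \oo --> l & (`|l|%:E <= limn_einf (fun j => `|g j|%:E))%E.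
Proof.
move=> bv einf; pose w j := expR (g j / 2).
have /cvg_ex[/= v wv] : cvgn w.
  have : cvgn (series (fun j => w j.+1 - w j)).
    apply: normed_cvg; apply: nondecreasing_is_cvgn.
      apply: nondecreasing_series => *; exact: normr_ge0.
    exists (fine (\sum_(0 <= j <oo) `|w j.+1 - w j|%:E)%E).
    move=> _ [N _ <-]; rewrite -lee_fin fineK; last first.
      rewrite ge0_fin_numE//; apply: nneseries_ge0 => *.
      by rewrite lee_fin.
    rewrite /series/= -sumEFin.
    by apply: nneseries_lim_ge => j _ _; rewrite lee_fin.
  move=> /cvg_ex[/= l cl]; apply/cvg_ex; exists (l + w 0%N).
  apply: cvg_trans (cvgD cl (cvg_cst (w 0%N))).
  apply: near_eq_cvg; apply: nearW => N.
  by rewrite fctE /series/= telescope_sumr// subrK.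
have v0 : 0 <= v.
  have <- : lim (w @ \oo) = v by apply/cvg_lim.
  apply: limr_ge; first by apply/cvg_ex; exists v.
  by apply: nearW => j; exact: expR_ge0.
have [v_eq0|v_neq0] := eqVneq v 0.
  suff goo : (fun j => `|g j|%:E)%E @ \oo --> +oo%E.
    by move: einf; rewrite (cvg_limn_einf_sup goo).1 ltxx.
  apply/cvgeryP/cvgryPge => A.
  have A0 : 0 < expR (- A / 2) by exact: expR_gt0.
  move/cvgr_lt : wv => /(_ (expR (- A / 2))); rewrite v_eq0 => /(_ A0).
  apply: filterS => j /=; rewrite /w ltr_expR => gA.
  have : A <= - g j by lra.
  by move=> /le_trans; apply; rewrite -normrN ler_norm.
have v_gt0 : 0 < v by rewrite lt_def v_neq0.
have lnw : (fun j => ln (w j)) @ \oo --> ln v.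
  by apply: continuous_cvg wv; exact: continuous_ln.
have gl : g @ \oo --> 2 * ln v.
  have h := cvgM (cvg_cst (2 : R)) lnw.
  apply: cvg_trans (h _ _); apply: near_eq_cvg; apply: nearW => j.
  by rewrite /= /w expRK; lra.
exists (2 * ln v) => //.
have cl : (fun j => `|g j|%:E) @ \oo --> `|2 * ln v|%:E.
  by apply: cvg_EFin; [exact: nearW|exact: cvg_norm].
by rewrite (cvg_limn_einf_sup cl).1.
Qed.

(** * Maximizing sequences selected by minimizing an exponential integral *)

Section expR_minimization.
Context {d : measure_display} {T : measurableType d} {R : realType}.
Variable P : probability T R.

Lemma integrable_expR_le0 (F : T -> R) :
  measurable_fun setT F -> {ae P, forall x, F x <= 0} ->
  P.-integrable setT (EFin \o (fun x => expR (F x))).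
Proof.
move=> mF F0; have mE : measurable_fun setT (fun x => expR (F x)).
  exact: measurableT_comp.
apply/integrableP; split; first exact/measurable_EFinP.
apply: (@le_lt_trans _ _ (\int[P]_x (cst 1%:E) x)%E); last first.
  by rewrite integral_cst//= probability_setT mule1 ltry.
apply: ae_ge0_le_integral => //.
  by apply: measurableT_comp => //; exact/measurable_EFinP.
apply: filterS F0 => x Fx _ /=.
by rewrite lee_fin ger0_norm ?expR_ge0// -[leRHS]expR0 ler_expR.
Qed.

Lemma Rintegral_expR_le1 (F : T -> R) :
  measurable_fun setT F -> {ae P, forall x, F x <= 0} ->
  \int[P]_x expR (F x) <= 1.
Proof.
move=> mF F0; have mE : measurable_fun setT (fun x => expR (F x)).
  exact: measurableT_comp.
rewrite -lee_fin fineK; last first.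
  by apply: integrable_fin_num => //; exact: integrable_expR_le0.
apply: (@le_trans _ _ (\int[P]_x (cst 1%:E) x)%E); last first.
  by rewrite integral_cst//= probability_setT mule1.
apply: ae_ge0_le_integral => //.
- exact/measurable_EFinP.
- apply: filterS F0 => x Fx _ /=.
  by rewrite lee_fin -[leRHS]expR0 ler_expR.
Qed.

Variables (K : set (T -> R)) (J : R).
Hypothesis KI : forall F, K F -> P.-integrable setT (EFin \o F).
Hypothesis K0 : forall F, K F -> {ae P, forall x, F x <= 0}.
Hypothesis Kmid : forall F G, K F -> K G -> K (fun x => (F x + G x) / 2).
Hypothesis KJ : forall e, 0 < e -> exists2 F, K F & J - e < \int[P]_x F x.

Let mK F : K F -> measurable_fun setT F.
Proof. by move=> /KI/integrableP[/measurable_EFinP]. Qed.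

Let IE F : K F -> P.-integrable setT (EFin \o (fun x => expR (F x))).
Proof. by move=> KF; apply: integrable_expR_le0; [exact: mK|exact: K0]. Qed.

(** [L] is the limit, as [r] tends to 0, of the infimum of the exponential integral over the [F] in
    [K] with integral above [J - r]. It is obtained as the supremum of the lower bounds that are
    valid for some [r]. *)
Lemma exists_asymptotic_inf_expR : exists L : R,
  (forall e, 0 < e -> exists2 r, 0 < r & forall F, K F ->
     J - r < \int[P]_x F x -> L - e < \int[P]_x expR (F x)) /\
  (forall e r, 0 < e -> 0 < r -> exists2 F, K F &
     J - r < \int[P]_x F x /\ \int[P]_x expR (F x) <= L + e).
Proof.
pose A := [set l : R | exists2 r, 0 < r & forall F, K F ->
  J - r < \int[P]_x F x -> l <= \int[P]_x expR (F x)].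
have supA : has_sup A.
  split.
    exists 0, 1 => // F KF _; apply: Rintegral_ge0 => x _; exact: expR_ge0.
  exists 1 => l [r r0 h]; have [F KF FJ] := KJ r r0.
  apply: (le_trans (h _ KF FJ)).
  by apply: Rintegral_expR_le1; [exact: mK|exact: K0].
exists (sup A); split=> [e e0|e r e0 r0].
  have [l [r r0 h] le_l] := sup_adherent e0 supA.
  by exists r => // F KF FJ; exact: lt_le_trans le_l (h _ KF FJ).
apply: contrapT => nF.
have /(ub_le_sup supA.2) : A (sup A + e).
  exists r => // F KF FJ; rewrite leNgt; apply/negP => /ltW lt_e.
  by apply: nF; exists F.
by rewrite leNgt ltrDl e0.
Qed.

(* [(e^(a/2) - e^(b/2))^2 = e^a + e^b - 2 e^((a+b)/2)] turns near-minimality of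
   the exponential integral into an [L^1] estimate *)
Lemma Rintegral_expR_half_dist (F G : T -> R) (L e q : R) : K F -> K G ->
  0 < q ->
  \int[P]_x expR (F x) <= L + e -> \int[P]_x expR (G x) <= L + e ->
  L - e <= \int[P]_x expR ((F x + G x) / 2) ->
  (\int[P]_x `|expR (F x / 2) - expR (G x / 2)|%:E <=
    (2 * e / q + q / 2)%:E)%E.
Proof.
move=> KF KG q0 FL GL ML; have KM := Kmid _ _ KF KG.
pose M x := (F x + G x) / 2.
(* Young's inequality [t <= t^2 / (2 q) + q / 2] with [t = |e^(F/2) - e^(G/2)|] makes [h] a
   pointwise bound. The numerator is [t^2], with integral at most [2 (L + e) - 2 (L - e) = 4 e]. *)
pose h x := (expR (F x) + expR (G x) - 2 * expR (M x)) / q / 2 + q / 2.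
have i2M : P.-integrable setT (EFin \o (fun x => 2 * expR (M x))).
  by apply: (eq_integrable measurableT _ _ _ (integrableZl measurableT 2 (IE _ KM))).
have iFG : P.-integrable setT (EFin \o (fun x => expR (F x) + expR (G x))).
  by apply: (eq_integrable measurableT _ _ _ (integrableD measurableT (IE _ KF) (IE _ KG))).
have i3 : P.-integrable setT
    (EFin \o (fun x => expR (F x) + expR (G x) - 2 * expR (M x))).
  by apply: (eq_integrable measurableT _ _ _ (integrableB measurableT iFG i2M)).
have i4 : P.-integrable setT
    (EFin \o (fun x => (q^-1 / 2) * (expR (F x) + expR (G x) - 2 * expR (M x)))).
  by apply: (eq_integrable measurableT _ _ _ (integrableZl measurableT (q^-1 / 2) i3)).
have ic : P.-integrable setT (EFin \o (fun=> q / 2)).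
  exact: finite_measure_integrable_cst.
have hE : h = (fun x =>
    (q^-1 / 2) * (expR (F x) + expR (G x) - 2 * expR (M x)) + q / 2).
  by apply/funext => x; rewrite /h; ring.
have ih : P.-integrable setT (EFin \o h).
  rewrite hE.
  by apply: (eq_integrable measurableT _ _ _ (integrableD measurableT i4 ic)).
have mE (H : T -> R) : K H -> measurable_fun setT (fun x => expR (H x / 2)).
  move=> KH; apply: measurableT_comp => //.
  by apply: measurable_funM => //; exact: mK.
apply: (@le_trans _ _ (\int[P]_x (h x)%:E)%E).
  apply: ge0_le_integral => //.
  - apply/measurable_EFinP; apply: measurableT_comp => //.
    by apply: measurable_funB; exact: mE.
  - exact: measurable_int ih.
  - move=> x _; rewrite lee_fin /h.
    have FE : expR (F x) = expR (F x / 2) ^+ 2.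
      by rewrite -expRM_natl; congr expR; lra.
    have GE : expR (G x) = expR (G x / 2) ^+ 2.
      by rewrite -expRM_natl; congr expR; lra.
    have ME : expR (M x) = expR (F x / 2) * expR (G x / 2).
      by rewrite -expRD; congr expR; rewrite /M; lra.
    rewrite FE GE ME; set u := expR _; set v := expR _.
    have -> : u ^+ 2 + v ^+ 2 - 2 * (u * v) = `|u - v| ^+ 2.
      by rewrite real_normK ?num_real//; ring.
    set t := `|u - v|.
    have : 0 <= (t - q) ^+ 2 / q by rewrite divr_ge0 ?sqr_ge0// ltW.
    have -> : (t - q) ^+ 2 / q = t ^+ 2 / q - 2 * t + q.
      by field; rewrite gt_eqF.
    lra.
rewrite -[leLHS]fineK; last exact: integrable_fin_num.
rewrite lee_fin -/(Rintegral P setT h) hE RintegralD//.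
rewrite Rintegral_cst//= probability_setT/= mulr1 lerD2r.
rewrite RintegralZl// RintegralB// RintegralD//; [|exact: IE..].
rewrite RintegralZl//; last exact: IE.
have : (\int[P]_x expR (F x) + \int[P]_x expR (G x) -
  2 * \int[P]_x expR (M x)) <= 4 * e by rewrite /M; lra.
move=> le4; rewrite (_ : 2 * e / q = q^-1 / 2 * (4 * e)); last first.
  by field; rewrite gt_eqF.
by rewrite ler_wpM2l// divr_ge0// invr_ge0 ltW.
Qed.

(** With [q j = 2^-j], a tolerance [q j ^+ 2] in the exponential integral and the weight [q j] in
    the half-distance estimate leave [2 q j + q j / 2 <= 3 q j], which is summable. *)
Lemma exists_expR_minimizing_sequence : exists G : nat -> T -> R,
  forall j, [/\ K (G j), J - 2^-1 ^+ j < \int[P]_x G j x &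
    (\int[P]_x `|expR (G j.+1 x / 2) - expR (G j x / 2)|%:E <=
     (3 * 2^-1 ^+ j)%:E)%E].
Proof.
have [L [Lge Lle]] := exists_asymptotic_inf_expR.
pose q j : R := 2^-1 ^+ j.
have q0 j : 0 < q j by rewrite exprn_gt0.
have e0 j : 0 < q j ^+ 2 by rewrite exprn_gt0.
have qS j : q j.+1 = q j / 2 by rewrite /q exprS mulrC.
have /choice[r rP] : forall j, exists r, 0 < r /\ forall F, K F ->
    J - r < \int[P]_x F x -> L - q j ^+ 2 < \int[P]_x expR (F x).
  by move=> j; have [r r0 h] := Lge _ (e0 j); exists r.
(* [r j] makes the lower bound on exponential integrals apply, and [q j] gives the required
   closeness to [J]. *)
have m0 j : 0 < Num.min (r j) (q j) by rewrite lt_min (rP j).1 q0.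
have /choice[G GP] : forall j, exists F, K F /\
    (J - Num.min (r j) (q j) < \int[P]_x F x /\
     \int[P]_x expR (F x) <= L + q j ^+ 2).
  by move=> j; have [F KF h] := Lle _ _ (e0 j) (m0 j); exists F.
exists G => j; split.
- exact: (GP j).1.
- apply: le_lt_trans (GP j).2.1.
  by rewrite lerD2l lerN2 ge_min lexx orbT.
- have KM := Kmid _ _ (GP j.+1).1 (GP j).1.
  have qle : q j.+1 ^+ 2 <= q j ^+ 2.
    by rewrite qS; have := q0 j; nra.
  have Gr i : J - r i < \int[P]_x G i x.
    apply: le_lt_trans (GP i).2.1.
    by rewrite lerD2l lerN2 ge_min lexx.
  have IM : \int[P]_x ((G j.+1 x + G j x) / 2) =
      (\int[P]_x G j.+1 x + \int[P]_x G j x) / 2.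
    have iD : P.-integrable setT (EFin \o (fun x => G j.+1 x + G j x)).
      apply: (eq_integrable measurableT _ _ _ (integrableD measurableT
        (KI _ (GP j.+1).1) (KI _ (GP j).1))) => //.
    rewrite RintegralZr// RintegralD//; exact: KI (GP _).1.
  have ML : L - q j ^+ 2 <= \int[P]_x expR ((G j.+1 x + G j x) / 2).
    have := Gr j; have := Gr j.+1 => G1 G2.
    (* The integral of the midpoint exceeds [J] minus the larger of the two radii, so the lower
       bound is applied at the index with the larger radius. *)
    have [rr|rr] := leP (r j.+1) (r j).
      by apply/ltW/((rP j).2 _ KM); rewrite IM; lra.
    apply: (@le_trans _ _ (L - q j.+1 ^+ 2)); first lra.
    by apply/ltW/((rP j.+1).2 _ KM); rewrite IM; lra.
  have GL : \int[P]_x expR (G j.+1 x) <= L + q j ^+ 2.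
    by apply: le_trans (GP j.+1).2.2 _; rewrite lerD2l.
  apply: (le_trans (Rintegral_expR_half_dist _ _ _ _ _ (GP j.+1).1 (GP j).1
    (q0 j) GL (GP j).2.2 ML)).
  rewrite lee_fin -/(q j).
  have -> : 2 * q j ^+ 2 / q j = 2 * q j by field; rewrite gt_eqF.
  have := q0 j; lra.
Qed.

(** [S] is the total variation of [expR (G j / 2)] plus the lower limit of [|G j|]; where it is
    finite, both hypotheses of [cvg_of_expR_bounded_variation] hold. *)
Lemma exists_cvg_maximizing_sequence :
  exists (G : nat -> T -> R) (S : T -> \bar R) (H : T -> R),
  [/\ forall j, K (G j),
      [/\ measurable_fun setT S, forall x, (0 <= S x)%E &
          (\int[P]_x S x < +oo)%E],
      measurable_fun setT H /\ (forall x, (`|H x|%:E <= S x)%E),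
      forall x, (S x < +oo)%E -> G ^~ x @ \oo --> H x &
      J <= \int[P]_x H x].
Proof.
have [G GP] := exists_expR_minimizing_sequence.
have mG j : measurable_fun setT (G j) by have [/mK] := GP j.
pose D j x : \bar R := `|expR (G j.+1 x / 2) - expR (G j x / 2)|%:E.
pose A j x : \bar R := `|G j x|%:E.
pose V x := (\sum_(0 <= j <oo) D j x)%E.
pose E x := limn_einf (A ^~ x).
have D0 j x : (0 <= D j x)%E by rewrite lee_fin.
have A0 j x : (0 <= A j x)%E by rewrite lee_fin.
have mD j : measurable_fun setT (D j).
  apply/measurable_EFinP; apply: measurableT_comp => //.
  by apply: measurable_funB; apply: measurableT_comp => //; apply: measurable_funM.
have mA j : measurable_fun setT (A j).
  by apply/measurable_EFinP; apply: measurableT_comp.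
have mV : measurable_fun setT V.
  by apply: ge0_emeasurable_sum => // j x _ _; exact: D0.
have mE : measurable_fun setT E.
  apply: measurableT_comp => //; apply: measurable_fun_limn_esup => j.
  by apply: measurableT_comp.
have V0 x : (0 <= V x)%E by apply: nneseries_ge0 => j _ _; exact: D0.
have E0 x : (0 <= E x)%E.
  rewrite /E limn_einf_lim; apply: lime_ge; first exact: is_cvg_einfs.
  by apply: nearW => j; apply: le_ereal_inf_tmp => _ [i _ <-].
have IV : (\int[P]_x V x < +oo)%E.
  rewrite /V integral_nneseries//.
  (* The constant 6 comes from [3 * 2^-j = 6 / 2^(j+1)], the form of the terms in
     [epsilon_trick]. *)
  have := @epsilon_trick R (fun=> 0%E) 6 xpredT (fun=> lexx _) (ler0n _ _).
  rewrite [X in (_ <= X + _)%E]eseries0// add0e => le6.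
  apply: (@le_lt_trans _ _ 6%:E); last exact: ltry.
  apply: le_trans le6; apply: lee_nneseries => [j _ _|j _].
    by apply: integral_ge0 => x _; exact: D0.
  rewrite ?add0e; have [_ _ /le_trans] := GP j; apply.
  by rewrite lee_fin exprVn natrX exprS invfM; lra.
have AG j : (\int[P]_x A j x = (- \int[P]_x G j x)%:E)%E.
  have [KG _ _] := GP j.
  rewrite EFinN fineK; last by apply: integrable_fin_num => //; exact: (KI _ KG).
  rewrite -integralN/=; last first.
    by apply: integrable_add_def => //; exact: (KI _ KG).
  apply: ae_eq_integral => //.
    by apply/measurable_EFinP; exact: measurable_funN.
  by apply: filterS (K0 _ KG) => x Gx _; rewrite /A ler0_norm.
(* Fatou's lemma: as [G j <= 0] almost everywhere, the integral of [|G j|] is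
   [- \int G j < - J + 2^-j]. *)
have IE_le : (\int[P]_x E x <= (- J)%:E)%E.
  apply: (le_trans (fatou _ _ mA _)) => //.
  have cJ : (- J + 2^-1 ^+ j)%:E @[j --> \oo] --> (- J)%:E.
    apply: cvg_EFin; first exact: nearW.
    rewrite -[X in _ --> X]addr0; apply: cvgD; first exact: cvg_cst.
    by apply: cvg_expr; rewrite ger0_norm// invf_lt1// ltr1n.
  rewrite limn_einf_lim -(cvg_lim _ cJ)//.
  apply: lee_lim; [exact: is_cvg_einfs|by apply/cvg_ex; eexists; exact: cJ|].
  apply: nearW => j; apply: (@le_trans _ _ (\int[P]_x A j x)%E).
    by apply: ereal_inf_lbound; exists j => /=.
  rewrite AG lee_fin; have [_ + _] := GP j; lra.
pose S x := (V x + E x)%E.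
have mS : measurable_fun setT S by exact: emeasurable_funD.
have S0 x : (0 <= S x)%E by exact: adde_ge0.
have IS : (\int[P]_x S x < +oo)%E.
  rewrite ge0_integralD// lte_add_pinfty//.
  exact: le_lt_trans IE_le (ltry _).
have Slim x : (S x < +oo)%E ->
    exists2 l, G ^~ x @ \oo --> l & (`|l|%:E <= S x)%E.
  move=> Sx; have [|| l Gl le_l] := cvg_of_expR_bounded_variation (G ^~ x).
  - by apply: le_lt_trans Sx; rewrite leeDl.
  - by apply: le_lt_trans Sx; rewrite leeDr.
  by exists l => //; apply: le_trans le_l _; rewrite leeDr.
pose B := [set x | (S x < +oo)%E].
have mB : measurable B.
  by rewrite -[B]setTI; exact: emeasurable_fun_infty_o.
(* Multiplying by the indicator of [B] makes the sequence converge everywhere, with limit 0 off [B],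
   so that [H] is measurable as a pointwise limit. *)
have /choice[H HP] : forall x, exists l, G ^~ x \* cst (\1_B x) @ \oo --> l /\
    (`|l|%:E <= S x)%E.
  move=> x; have [Sx|Sx] := boolP (S x < +oo)%E.
    have [l Gl le_l] := Slim x Sx; exists l; split => //.
    rewrite indicE mem_set//=; apply: cvg_trans Gl.
    by apply: near_eq_cvg; apply: nearW => j /=; rewrite mulr1.
  exists 0; split; last by rewrite normr0.
  have -> : \1_B x = 0 :> R by rewrite indicE memNset// => h; move: Sx; rewrite h.
  have c0 : (fun=> 0 : R) @ \oo --> (0 : R) by exact: cvg_cst.
  apply: cvg_trans c0.
  by apply: near_eq_cvg; apply: nearW => j /=; rewrite mulr0.
have HG x : (S x < +oo)%E -> G ^~ x @ \oo --> H x.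
  move=> Sx; have [+ _] := HP x; rewrite indicE mem_set//; apply: cvg_trans.
  by apply: near_eq_cvg; apply: nearW => j /=; rewrite mulr1.
have mH : measurable_fun setT H.
  apply: (@measurable_fun_cvg _ _ _ _ (fun j x => G j x * \1_B x)).
    by move=> j; apply: measurable_funM => //; exact: measurable_indic.
  by move=> x _; have [] := HP x.
exists G, S, H; split => //.
- by move=> j; have [] := GP j.
- by split => // x; have [] := HP x.
have Sae : {ae P, forall x, (S x < +oo)%E}.
  have : P.-integrable setT S.
    apply/integrableP; split => //.
    by under eq_integral do rewrite gee0_abs//.
  move=> /(integrable_ae measurableT); apply: filterS => x /(_ Logic.I).
  by rewrite ge0_fin_numE.
have HE : {ae P, forall x, setT x -> (EFin \o Num.norm \o H) x = E x}.
  apply: filterS Sae => x Sx _; have Gx := HG _ Sx.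
  have cl : A ^~ x @ \oo --> `|H x|%:E.
    by apply: cvg_EFin; [exact: nearW|exact: cvg_norm].
  by rewrite /E (cvg_limn_einf_sup cl).1.
have IH : (\int[P]_x `|(H x)%:E| <= (- J)%:E)%E.
  rewrite (ge0_ae_eq_integral _ _ _ _ _ HE)//.
    by apply/measurable_EFinP; exact: measurableT_comp.
  by move=> x _; rewrite lee_fin.
have iH : P.-integrable setT (EFin \o H).
  apply/integrableP; split; first exact/measurable_EFinP.
  by apply: le_lt_trans IH _; exact: ltry.
(* It remains to see [- \int H <= - J], which follows from [|\int H| <= \int |H| <= - J]. *)
rewrite -lerN2.
have := le_normr_Rintegral measurableT iH.
have : \int[P]_x `|H x| <= - J.
  rewrite -lee_fin fineK//; apply: integrable_fin_num => //.
  exact: integrable_norm.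
move=> h1 h2; apply: le_trans h1; apply: le_trans h2.
by rewrite -normrN ler_norm.
Qed.

End expR_minimization.

(** * Truncated inclusion-exclusion over finite subsets *)

Section subset_inclusion_exclusion.
Context {I : finType} {R : numDomainType}.

Let toggle (i : I) (b : {set I}) : {set I} := if i \in b then b :\ i else i |: b.

Let toggleK i : involutive (toggle i).
Proof.
move=> b; rewrite /toggle; case ib: (i \in b).
  by rewrite finset.setD11 finset.setD1K.
by rewrite finset.setU11 finset.setU1K ?ib.
Qed.

Let sign_toggle i (b : {set I}) : (-1) ^+ #|toggle i b| = - (-1) ^+ #|b| :> R.
Proof.
rewrite /toggle; case: ifPn => ib; last by rewrite cardsU1 ib exprS mulN1r.
by rewrite [in RHS](cardsD1 i) ib exprS mulN1r opprK.
Qed.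

(** Toggling the membership of [i] is an involution that preserves [Q] and [F] and reverses the
    sign, so the sum equals its own opposite. *)
Lemma sum_toggle_eq0 (i : I) (Q : pred {set I}) (F : {set I} -> R) :
  (forall b : {set I}, i \notin b -> Q (i |: b) = Q b) ->
  (forall b : {set I}, i \notin b -> F (i |: b) = F b) ->
  \sum_(b | Q b) (-1) ^+ #|b| * F b = 0.
Proof.
move=> Qi Fi; set s := LHS.
have Q_toggle b : Q (toggle i b) = Q b.
  rewrite /toggle; case: ifPn => ib; last exact: Qi.
  by rewrite -Qi ?finset.setD1K// finset.setD11.
have F_toggle b : F (toggle i b) = F b.
  rewrite /toggle; case: ifPn => ib; last exact: Fi.
  by rewrite -Fi ?finset.setD1K// finset.setD11.
have : s = - s.
  rewrite {1}/s (reindex_inj (inv_inj (toggleK i)))/= /s -sumrN.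
  apply: eq_big => [b|b _]; first exact: Q_toggle.
  by rewrite F_toggle sign_toggle mulNr.
by move=> /eqP; rewrite -subr_eq0 opprK -mulr2n mulrn_eq0 => /eqP.
Qed.

(* Moebius inversion on the subset lattice; the terms with [#|b| > k] vanish
   because no summand of [phi] depends on more than [k] elements *)
Lemma inclusion_exclusion_truncated (k : nat) (A : pred {set I})
    (psi : {set I} -> {set I} -> R) (phi : {set I} -> R) :
  (forall a, A a -> (#|a| <= k)%N) ->
  (forall d, phi d = \sum_(a | A a) psi a (a :&: d)) ->
  \sum_(b : {set I} | (#|b| <= k)%N) (-1) ^+ #|b| *
     \sum_(d : {set I} | d \subset b) (-1) ^+ #|d| * phi d = phi [set: I]%SET.
Proof.
move=> Ak phiE.
pose Delta (b : {set I}) := \sum_(d : {set I} | d \subset b) (-1) ^+ #|d| * phi d.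
have Delta0 (b : {set I}) : (k < #|b|)%N -> Delta b = 0.
  move=> kb; rewrite /Delta.
  under eq_bigr do rewrite phiE mulr_sumr.
  rewrite exchange_big/= big1// => a Aa.
  (* Some [i] of [b] lies outside [a]; toggling it in [d] leaves [a :&: d] unchanged. *)
  have /subsetPn[i ib ia] : ~~ (b \subset a).
    apply/negP => /subset_leq_card; rewrite leqNgt => /negP; apply.
    exact: leq_ltn_trans (Ak _ Aa) kb.
  apply: (sum_toggle_eq0 i) => d id; first by rewrite finset.subUset finset.sub1set ib.
  congr (psi a _); apply/setP => j; rewrite !inE.
  by case: eqVneq => // ->; rewrite (negbTE ia).
transitivity (\sum_(b : {set I}) (-1) ^+ #|b| * Delta b).
  rewrite [RHS](bigID (fun b : {set I} => (#|b| <= k)%N))/=.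
  rewrite [X in _ = _ + X]big1 ?addr0// => b.
  by rewrite -ltnNge => /Delta0 ->; rewrite mulr0.
under eq_bigr do rewrite /Delta mulr_sumr.
(* After the exchange, [phi d] is multiplied by an alternating sum over the [b] containing [d]. It
   vanishes unless [d] is the full set, where the two signs multiply to 1. *)
rewrite (exchange_big_dep xpredT)//= (bigD1 [set: I]%SET)//=.
rewrite [X in _ + X]big1 ?addr0.
  rewrite (eq_bigl (pred1 [set: I]%SET)); last by move=> b; rewrite finset.subTset.
  by rewrite big_pred1_eq mulrA -exprD addnn -mul2n exprM sqrrN !expr1n mul1r.
move=> d dT; have /subsetPn[i _ id] : ~~ ([set: I]%SET \subset d) by rewrite finset.subTset.
apply: (sum_toggle_eq0 i) => b ib //.
rewrite -[in RHS](finset.setU1K ib) finset.subsetD1 id andbT.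
by [].
Qed.

End subset_inclusion_exclusion.

(** * Mixing coordinates in the product space *)

Section product_space.
Context {n : nat} (X : 'I_n -> ptopologicalType).

Lemma measurable_coordX (i : 'I_n) :
  measurable_fun setT (fun x : XX X => x i : borelX X i).
Proof.
move=> _ B mB; rewrite setTI; apply: sub_sigma_algebra.
by exists i, B.
Qed.

Lemma measurable_coordXA (a : {set 'I_n}) (i : {i | i \in a}) :
  measurable_fun setT (fun z : XA X a => z i : borelX X (val i)).
Proof.
move=> _ B mB; rewrite setTI; apply: sub_sigma_algebra.
by exists i, B.
Qed.

Lemma measurable_to_XX {d} {T : measurableType d} (f : T -> XX X) :
  (forall i, measurable_fun setT (fun t => f t i : borelX X i)) ->
  measurable_fun setT f.
Proof.
move=> mf; apply: (@measurability _ _ T (XX X) setT f (cylX X) erefl)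
  => _ [_ [i [B [mB ->]]] <-].
exact: mf.
Qed.

Lemma measurable_to_XA {d} {T : measurableType d} (a : {set 'I_n})
    (f : T -> XA X a) :
  (forall i, measurable_fun setT (fun t => f t i : borelX X (val i))) ->
  measurable_fun setT f.
Proof.
move=> mf; apply: (@measurability _ _ T (XA X a) setT f (cylA X a) erefl)
  => _ [_ [i [B [mB ->]]] <-].
exact: mf.
Qed.

Lemma measurable_Pr (a : {set 'I_n}) : measurable_fun setT (Pr X a).
Proof. by apply: measurable_to_XA => i; exact: measurable_coordX. Qed.

Definition mix (d : {set 'I_n}) (x y : XX X) : XX X :=
  fun i => if i \in d then x i else y i.

(** A point of [XA X a] takes indices paired with a membership proof, which [pselect] supplies. With
    [y] fixed, a function on the whole space can thus be read as a function of the [a]-coordinates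
    alone. *)
Definition extend (a : {set 'I_n}) (y : XX X) (z : XA X a) : XX X :=
  fun i => match pselect (i \in a) with
    | left ia => z (exist _ i ia)
    | right _ => y i
  end.

Lemma extendE (a : {set 'I_n}) (y x : XX X) : extend a y (Pr X a x) = mix a x y.
Proof.
apply: functional_extensionality_dep => i; rewrite /extend /mix /Pr/=.
by case: pselect => [->|/negP/negbTE ->].
Qed.

Lemma measurable_extend (a : {set 'I_n}) (y : XX X) :
  measurable_fun setT (extend a y).
Proof.
apply: measurable_to_XX => i; rewrite /extend.
case: pselect => ia; last exact: measurable_cst.
exact: (measurable_coordXA a (exist _ i ia)).
Qed.

Lemma mix_mix (a d : {set 'I_n}) (x y : XX X) :
  d \subset a -> mix d (mix a x y) y = mix d x y.
Proof.
move=> /fintype.subsetP da; apply: functional_extensionality_dep => i; rewrite /mix.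
by case: ifPn => // /da ->.
Qed.

Lemma mixT (x y : XX X) : mix [set: 'I_n]%SET x y = x.
Proof. by apply: functional_extensionality_dep => i; rewrite /mix finset.in_setT. Qed.

(** This is the dependence on [a :&: d] alone that [inclusion_exclusion_truncated] asks of each
    summand. *)
Lemma Pr_mixI (a d : {set 'I_n}) (x y : XX X) :
  Pr X a (mix (a :&: d) x y) = Pr X a (mix d x y).
Proof.
apply: functional_extensionality_dep => -[i ia].
by rewrite /Pr /mix/= finset.inE ia.
Qed.

Lemma measurable_mix (d : {set 'I_n}) :
  measurable_fun setT (fun w : XX X * XX X => mix d w.1 w.2).
Proof.
apply: measurable_to_XX => i; rewrite /mix; case: (i \in d).
  by apply: (measurableT_comp (measurable_coordX i)).
by apply: (measurableT_comp (measurable_coordX i)).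
Qed.

Lemma mix_inclusion_exclusion {R : numDomainType} (k : nat)
    (g : forall a, XA X a -> R) (x y : XX X) :
  \sum_(b : {set 'I_n} | (#|b| <= k)%N) (-1) ^+ #|b| *
    (\sum_(d : {set 'I_n} | d \subset b) (-1) ^+ #|d| *
      \sum_(a : {set 'I_n} | #|a| == k) g a (Pr X a (mix d x y))) =
  \sum_(a : {set 'I_n} | #|a| == k) g a (Pr X a x).
Proof.
pose psi (a d : {set 'I_n}) := g a (Pr X a (mix d x y)).
pose phi d := \sum_(a : {set 'I_n} | #|a| == k) g a (Pr X a (mix d x y)).
rewrite (inclusion_exclusion_truncated k (fun a => #|a| == k) psi phi).
- by rewrite /phi mixT.
- by move=> a /eqP ->.
- by move=> d; apply: eq_bigr => a _; rewrite /psi Pr_mixI.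
Qed.

(** * Invariance of a product measure under mixing *)

Section product_measure.
Context {R : realType} (nu : forall i, probability (borelX X i) R).
Variable P : probability (XX X) R.
Hypothesis Pnu : is_product_measure R n X nu P.

(** A generating pi-system on which [is_product_measure] prescribes the values of [P]. *)
Let boxes : set (set (XX X)) :=
  [set B | exists2 A : forall i, set (X i),
    (forall i, measurable (A i : set (borelX X i))) &
    B = [set x | forall i, A i (x i)]].

Let measurable_box (A : forall i, set (X i)) :
  (forall i, measurable (A i : set (borelX X i))) ->
  measurable ([set x | forall i, A i (x i)] : set (XX X)).
Proof.
move=> mA; rewrite (_ : [set x | _] =
    \bigcap_(i in setT) ((fun x : XX X => x i) @^-1` A i)); last first.
  by apply/seteqP; split => [x Ax i _|x Ax i]; exact: Ax.
apply: fin_bigcap_measurable => // i _.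
by rewrite -[X in measurable X]setTI; exact: measurable_coordX.
Qed.

Let setI_closed_boxes : setI_closed boxes.
Proof.
move=> _ _ [A mA ->] [B mB ->]; exists (fun i => A i `&` B i).
  by move=> i; exact: measurableI.
by apply/seteqP; split => [x [Ax Bx] i|x ABx]; [|split=> i; case: (ABx i)].
Qed.

Let measurable_XXE : @measurable _ (XX X) = <<s boxes >>.
Proof.
apply/seteqP; split; last first.
  apply: smallest_sub; first exact: sigma_algebra_measurable.
  by move=> _ [A mA ->]; exact: measurable_box.
apply: smallest_sub; first exact: smallest_sigma_algebra.
move=> _ [i [B [mB ->]]]; apply: sub_sigma_algebra.
exists (dfwith (fun j => setT : set (X j)) i B).
  by move=> j; case: dfwithP => // *; exact: measurableT.
apply/seteqP; split => [x Bx j|x /(_ i)]; last by rewrite dfwithin.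
by case: dfwithP.
Qed.

(** By uniqueness on a pi-system it suffices to treat boxes. The preimage of a box is a product of
    two boxes, one constrained only on [d] and the other only off [d], whose measures multiply to
    that of the box. *)
Lemma product_measure_mix (d : {set 'I_n}) (A : set (XX X)) : measurable A ->
  (P \x P)%E ((fun w => mix d w.1 w.2) @^-1` A) = P A.
Proof.
move: A; apply: (measure_unique boxes (fun=> setT) measurable_XXE
  setI_closed_boxes _ _ (pushforward (P \x P)%E (fun w => mix d w.1 w.2)) P).
- by move=> _; exists (fun i => setT) => //; apply/seteqP; split.
- exact: bigcup_const.
- exact: measurable_mix.
- move=> mm _ [A mA ->]; rewrite /pushforward/=.
  pose A1 i : set (X i) := if i \in d then A i else setT.
  pose A2 i : set (X i) := if i \in d then setT else A i.
  have mA1 i : measurable (A1 i : set (borelX X i)).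
    by rewrite /A1; case: ifPn => // _; exact: measurableT.
  have mA2 i : measurable (A2 i : set (borelX X i)).
    by rewrite /A2; case: ifPn => // _; exact: measurableT.
  transitivity ((P \x P)%E
    ([set x : XX X | forall i, A1 i (x i)] `*`
     [set x : XX X | forall i, A2 i (x i)])).
    congr (product_measure1 _ _ _).
    apply/seteqP; split => [[x y]/= Axy|[x y]/= [Ax Ay] i].
      by split=> i; have := Axy i; rewrite /mix /A1 /A2; case: ifPn.
    by have := Ax i; have := Ay i; rewrite /mix /A1 /A2; case: ifPn.
  rewrite product_measure1E; [|exact: measurable_box..].
  rewrite [X in (X * _)%E](Pnu _ mA1) [X in (_ * X)%E](Pnu _ mA2).
  rewrite [RHS](Pnu _ mA) -big_split/=; apply: eq_bigr => i _.
  rewrite /A1 /A2; case: ifPn => _.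
    by rewrite [X in (_ * X)%E = _]probability_setT mule1.
  by rewrite [X in (X * _)%E = _]probability_setT mul1e.
- move=> mm _; change ((P \x P)%E setT < +oo)%E.
  rewrite -setXTT product_measure1E// [X in (X * _)%E](_ : _ = 1%E).
    by rewrite mul1e [X in (X < _)%E](_ : _ = 1%E) ?ltry//; exact: probability_setT.
  exact: probability_setT.
Qed.

Lemma integral_mix (d : {set 'I_n}) (S : XX X -> \bar R) :
  measurable_fun setT S -> (forall x, (0 <= S x)%E) ->
  (\int[P]_y \int[P]_x S (mix d x y) = \int[P]_x S x)%E.
Proof.
move=> mS S0; have mSm : measurable_fun setT
    (fun w : XX X * XX X => S (mix d w.1 w.2)).
  exact: measurableT_comp mS (measurable_mix d).
rewrite -(fubini_tonelli2 (fun w => S (mix d w.1 w.2)) mSm)//.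
rewrite -[LHS](@ge0_integral_pushforward _ _ _ _ _ _ (measurable_mix d) _ setT S)//.
apply: eq_measure_integral => [|mm A mA _]; first exact: measurable_mix.
exact: (product_measure_mix d A mA).
Qed.

(** One [y] must serve all [d], so Tonelli is applied to the finite sum over [d] of the partial
    integrals: it is integrable in [y], hence finite almost everywhere. *)
Lemma exists_integrable_mix (S : XX X -> \bar R) :
  measurable_fun setT S -> (forall x, (0 <= S x)%E) -> (\int[P]_x S x < +oo)%E ->
  exists y, forall d, (\int[P]_x S (mix d x y) < +oo)%E.
Proof.
move=> mS S0 IS.
have mSm d : measurable_fun setT (fun w : XX X * XX X => S (mix d w.1 w.2)).
  exact: measurableT_comp mS (measurable_mix d).
pose F d y := (\int[P]_x S (mix d x y))%E.
have F0 d y : (0 <= F d y)%E by apply: integral_ge0.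
have mF d : measurable_fun setT (F d).
  exact: (measurable_fun_fubini_tonelli_G (fun w => S (mix d w.1 w.2))).
have mFs : measurable_fun setT (fun y => \sum_(d : {set 'I_n}) F d y)%E.
  exact: emeasurable_sum.
have iF : P.-integrable setT (fun y => \sum_(d : {set 'I_n}) F d y)%E.
  apply/integrableP; split => //.
  under eq_integral do rewrite gee0_abs ?sume_ge0//.
  rewrite ge0_integral_sum//; apply: lte_sum_pinfty => d _.
  by rewrite /F integral_mix.
(* [P] has mass 1, so what holds almost everywhere holds somewhere. *)
have proper : ProperFilter (almost_everywhere P).
  by apply: ae_properfilter_algebraOfSetsType; rewrite [ltRHS]probability_setT lte01.
have [y /(_ Logic.I) Fy] := @filter_ex _ _ proper _ (integrable_ae measurableT iF).
exists y => d; apply: le_lt_trans (_ : \sum_(d : {set 'I_n}) F d y < +oo)%E.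
  by rewrite (bigD1 d)//= leeDl// sume_ge0.
by rewrite -ge0_fin_numE// sume_ge0.
Qed.

End product_measure.

End product_space.

(** * Integrability under uniformly equivalent measures *)

(** The density bounds give [a * P2 <= P1 <= b * P2] on measurable sets, hence the same comparison
    for integrals of nonnegative functions. *)
Lemma unif_equiv_integral_lty {n : nat} {X : 'I_n -> ptopologicalType}
    {R : realType} (P1 P2 : probability (XX X) R) (f : XX X -> \bar R) :
  unif_equiv R n X P1 P2 -> measurable_fun setT f -> (forall x, (0 <= f x)%E) ->
  (\int[P1]_x f x < +oo)%E <-> (\int[P2]_x f x < +oo)%E.
Proof.
move=> [rho [mrho [a [b [a0 [ab P12]]]]]] mf f0.
have [x0] : (setT : set (XX X)) !=set0 by exists point.
move=> _; have b0 : 0 <= b.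
  by have /andP[] := ab x0 => h1 h2; apply: le_trans h2; apply: le_trans h1; exact: ltW.
have rho0 x : (0 <= (rho x)%:E)%E.
  by rewrite lee_fin; have /andP[h _] := ab x; apply: le_trans h; exact: ltW.
have mrhoE A : measurable A -> measurable_fun A (EFin \o rho).
  by move=> mA; apply: measurable_funTS; exact/measurable_EFinP.
have aP A : measurable A -> (mscale (NngNum (ltW a0)) P2 A <= P1 A)%E.
  move=> mA; rewrite P12// -[X in (X <= _)%E](integral_cst P2 mA a%:E).
  apply: ge0_le_integral => //; try exact: mrhoE.
  - by move=> x _; rewrite lee_fin ltW.
  - by move=> x _; rewrite lee_fin; have /andP[] := ab x.
have bP A : measurable A -> (P1 A <= mscale (NngNum b0) P2 A)%E.
  move=> mA; rewrite P12// -[X in (_ <= X)%E](integral_cst P2 mA b%:E).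
  apply: ge0_le_integral => //; try exact: mrhoE.
  by move=> x _; rewrite lee_fin; have /andP[] := ab x.
have I2 : (0 <= \int[P2]_x f x)%E by exact: integral_ge0.
have := ge0_le_measure_integral aP measurableT f0 mf.
have := ge0_le_measure_integral bP measurableT f0 mf.
rewrite !ge0_integral_mscale//= => leb lea; split => fin.
  have := le_lt_trans lea fin.
  case: (\int[P2]_x f x)%E I2 => [r _ _||//]; first exact: ltry.
  by move=> _; rewrite gt0_muley ?lte_fin.
apply: le_lt_trans leb _; move: fin.
by case: (\int[P2]_x f x)%E I2 => [r _ _|//|//]; rewrite -EFinM ltry.
Qed.

(** * Measures with prescribed marginals and sets of zero thickness *)

Section multistochastic.
Context {R : realType} {n k : nat} {X : 'I_n -> ptopologicalType}.
Variable mu : forall a : {set 'I_n}, probability (XA X a) R.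
Variable pi : probability (XX X) R.
Hypothesis pi_mu : forall a : {set 'I_n}, #|a| = k ->
  forall A, measurable A -> pi (Pr X a @^-1` A) = mu a A.

Definition sum_Pr (f : forall a : {set 'I_n}, XA X a -> R) (x : XX X) : R :=
  \sum_(a : {set 'I_n} | #|a| == k) f a (Pr X a x).

Lemma ge0_integral_Pr (a : {set 'I_n}) (f : XA X a -> \bar R) : #|a| = k ->
  measurable_fun setT f -> (forall z, (0 <= f z)%E) ->
  (\int[mu a]_z f z = \int[pi]_x f (Pr X a x))%E.
Proof.
move=> ak mf f0.
rewrite -[RHS](@ge0_integral_pushforward _ _ _ _ _ _ (measurable_Pr X a) _ setT f)//.
apply/esym/eq_measure_integral => [|mp A mA _]; first exact: measurable_Pr.
exact: (pi_mu a ak A mA).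
Qed.

Lemma integrable_Pr (a : {set 'I_n}) (f : XA X a -> R) : #|a| = k ->
  (mu a).-integrable setT (EFin \o f) ->
  pi.-integrable setT (fun x => (f (Pr X a x))%:E).
Proof.
move=> ak /integrableP[mf fi]; apply/integrableP; split.
  exact: (measurableT_comp mf (measurable_Pr X a)).
rewrite -(ge0_integral_Pr a (fun z => `|(f z)%:E|%E) ak)//.
exact: measurableT_comp.
Qed.

Lemma integral_Pr (a : {set 'I_n}) (f : XA X a -> R) : #|a| = k ->
  (mu a).-integrable setT (EFin \o f) ->
  (\int[mu a]_z (f z)%:E = \int[pi]_x (f (Pr X a x))%:E)%E.
Proof.
move=> ak fi.
rewrite -[RHS](@integral_pushforward _ _ _ _ _ _ (measurable_Pr X a) _ setT
  (EFin \o f))//.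
- apply/esym/eq_measure_integral => [|mp A mA _]; first exact: measurable_Pr.
  exact: (pi_mu a ak A mA).
- by case/integrableP : fi.
- exact: integrable_Pr.
Qed.

Lemma integrable_sum_Pr (f : forall a : {set 'I_n}, XA X a -> R) :
  (forall a : {set 'I_n}, #|a| = k -> (mu a).-integrable setT (EFin \o f a)) ->
  pi.-integrable setT (EFin \o sum_Pr f).
Proof.
move=> fi.
have : pi.-integrable setT (fun x =>
    \sum_(a <- index_enum {set 'I_n} | #|a| == k) (f a (Pr X a x))%:E)%E.
  by apply: integrable_sum => // a /eqP ak; apply: integrable_Pr; [|exact: fi].
by apply: eq_integrable => // x _; rewrite /= sumEFin.
Qed.

(** Each [mu a] is the image of [pi], so all the integrals can be taken over the whole space and
    added: the dual value depends only on the function [sum_Pr f]. *)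
Lemma dual_valueE (f : forall a : {set 'I_n}, XA X a -> R) :
  (forall a : {set 'I_n}, #|a| = k -> (mu a).-integrable setT (EFin \o f a)) ->
  dual_value R n k X mu f = (\int[pi]_x sum_Pr f x)%:E.
Proof.
move=> fi; rewrite fineK; last first.
  by apply: integrable_fin_num => //; exact: integrable_sum_Pr.
rewrite /dual_value; under eq_integral do rewrite -sumEFin.
(* The value 0 for [#|a| != k] makes the summand integrable at every index. *)
pose F (a : {set 'I_n}) x : \bar R := if #|a| == k then (f a (Pr X a x))%:E else 0%E.
have Fi (a : {set 'I_n}) : pi.-integrable setT (F a).
  rewrite /F; case: eqVneq => ak; last exact: integrable0.
  by apply: integrable_Pr => //; exact: fi.
transitivity (\int[pi]_x \sum_(a : {set 'I_n} | #|a| == k) F a x)%E.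
  rewrite integral_sum//; apply: eq_bigr => a ak.
  by rewrite /F ak; apply: integral_Pr; [exact/eqP|exact/fi/eqP].
by apply: eq_integral => x _; apply: eq_bigr => a ak; rewrite /F ak.
Qed.

Lemma zero_thick_Pr (Y : forall a : {set 'I_n}, set (XA X a)) :
  (forall a : {set 'I_n}, #|a| = k -> measurable (Y a) /\ mu a (Y a) = 0%E) ->
  zero_thick R n k X mu
    (\bigcup_(a in [set a : {set 'I_n} | #|a| = k]) (Pr X a @^-1` Y a)).
Proof.
move=> Y0; split; last by exists Y; split.
apply: fin_bigcup_measurable => // a ak.
by rewrite -[X in measurable X]setTI; apply: measurable_Pr => //; have [] := Y0 a ak.
Qed.

Lemma zero_thick_bigcup (A : nat -> set (XX X)) :
  (forall j, zero_thick R n k X mu (A j)) ->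
  zero_thick R n k X mu (\bigcup_j A j).
Proof.
move=> A0; have /choice[Y YP] := fun j => (A0 j).2.
split; first by apply: bigcup_measurable => j _; have [] := A0 j.
exists (fun a => \bigcup_j Y j a); split.
  move=> a ak; have mY j : measurable (Y j a) by have [/(_ a ak)[]] := YP j.
  split; first exact: bigcup_measurable.
  have : (mu a).-negligible (\bigcup_j Y j a).
    apply: negligible_bigcup => j; exists (Y j a); split => //.
    by have [/(_ a ak)[]] := YP j.
  by move/measure_negligible; apply; exact: bigcup_measurable.
move=> x [j _ /((YP j).2)[a ak Yx]]; exists a => //.
by exists j.
Qed.

Lemma zero_thickU (A B : set (XX X)) : zero_thick R n k X mu A ->
  zero_thick R n k X mu B -> zero_thick R n k X mu (A `|` B).
Proof.
move=> A0 B0; have : zero_thick R n k X mu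
    (\bigcup_(j : nat) (if j == 0%N then A else B)).
  by apply: zero_thick_bigcup => j; case: ifP.
rewrite (_ : \bigcup_j _ = A `|` B)//; apply/seteqP; split => x.
  by move=> [j _]; case: ifP => _; [left|right].
by case=> h; [exists 0%N|exists 1%N].
Qed.

(** Each cylinder over [Y a] has [pi]-measure [mu a (Y a) = 0], and there are finitely many [a]. *)
Lemma zero_thick_ae (A : set (XX X)) : zero_thick R n k X mu A ->
  {ae pi, forall x, ~ A x}.
Proof.
move=> [mA [Y [Y0 AY]]].
have : {ae pi, forall x, forall a : {set 'I_n}, #|a| = k -> ~ Y a (Pr X a x)}.
  apply: filter_forall => a; have [ak|ak] := eqVneq #|a| k; last first.
    by apply: nearW => x /eqP; rewrite (negbTE ak).
  have [mY Ya0] := Y0 a ak.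
  exists (Pr X a @^-1` Y a); split.
  - by rewrite -[X in measurable X]setTI; exact: measurable_Pr.
  - exact: etrans (pi_mu a ak _ mY) Ya0.
  - by move=> x /= /not_implyP[_ /contrapT].
by apply: filterS => x Yx /AY[a ak]; exact: Yx.
Qed.

End multistochastic.

(** * Convergence of the components off a thin set *)

Section components.
Context {R : realType} {n k : nat} {X : 'I_n -> ptopologicalType}.
Variable mu : forall a : {set 'I_n}, probability (XA X a) R.
Variables (pi P : probability (XX X) R) (nu : forall i, probability (borelX X i) R).
Hypothesis pi_mu : forall a : {set 'I_n}, #|a| = k ->
  forall A, measurable A -> pi (Pr X a @^-1` A) = mu a A.
Hypothesis Pnu : is_product_measure R n X nu P.
Hypothesis piP : unif_equiv R n X pi P.
Hypothesis kn : (k <= n)%N.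

(** [alpha b] is the [k]-set whose component will absorb the inclusion-exclusion terms indexed by
    [b]. *)
Lemma exists_superset_card : exists alpha : {set 'I_n} -> {set 'I_n},
  forall b : {set 'I_n}, (#|b| <= k)%N -> b \subset alpha b /\ #|alpha b| = k.
Proof.
suff /choice[alpha H] : forall b : {set 'I_n}, exists a : {set 'I_n},
    (#|b| <= k)%N -> b \subset a /\ #|a| = k by exists alpha.
move=> b; have [bk|] := leqP #|b| k; last by exists b.
have kcard : (k - #|b| <= #|~: b|)%N.
  by rewrite leq_subLR cardsC card_ord.
have [c [cb ck]] : exists c : {set 'I_n}, c \subset ~: b /\ #|c| = (k - #|b|)%N.
  have : (0 < #|[set c : {set 'I_n} |
      (c \subset ~: b) && (#|c| == (k - #|b|)%N)]%SET|)%N.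
    by rewrite cards_draws bin_gt0.
  by move=> /card_gt0P[c]; rewrite finset.inE => /andP[cb /eqP ck]; exists c.
exists (b :|: c)%SET => _; split; first exact: finset.subsetUl.
rewrite cardsU (_ : b :&: c = finset.set0) ?cards0 ?subn0 ?ck ?subnKC//.
apply/eqP; rewrite finset.setI_eq0 disjoint_sym finset.disjoints_subset//.
Qed.

(* Almost every [y] makes all the sections [L (mix d . y)] integrable.  With such a
   [y] fixed, the components are recovered from the limit [L] by
   inclusion-exclusion, so that they converge outside a set which is thin
   coordinatewise, and not merely almost everywhere. *)
Lemma exists_cvg_components (g : nat -> forall a : {set 'I_n}, XA X a -> R)
    (S : XX X -> \bar R) (L : XX X -> R) :
  measurable_fun setT S -> (forall x, (0 <= S x)%E) ->
  (\int[pi]_x S x < +oo)%E ->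
  measurable_fun setT L -> (forall x, (`|L x|%:E <= S x)%E) ->
  (forall x, (S x < +oo)%E -> (fun j => sum_Pr (k := k) (g j) x) @ \oo --> L x) ->
  exists (h : forall a : {set 'I_n}, XA X a -> R)
         (Y : forall a : {set 'I_n}, set (XA X a)),
    [/\ forall a : {set 'I_n}, #|a| = k -> (mu a).-integrable setT (EFin \o h a),
        forall a : {set 'I_n}, #|a| = k -> measurable (Y a) /\ mu a (Y a) = 0%E &
        forall x, (forall a : {set 'I_n}, #|a| = k -> ~ Y a (Pr X a x)) ->
          (fun j => sum_Pr (k := k) (g j) x) @ \oo --> sum_Pr (k := k) h x].
Proof.
move=> mS S0 IS mL LS gL.
have [alpha alphaP] := exists_superset_card.
(* Invariance under [mix] is known for the product [P], so the integrability of [S] is moved from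
   [pi] to [P]; that of the sections is moved back to [pi] in [ISu]. *)
have ISP := (unif_equiv_integral_lty pi P S piP mS S0).1 IS.
have [y Sy] := exists_integrable_mix X nu P Pnu S mS S0 ISP.
have mmix d : measurable_fun setT (fun x : XX X => mix X d x y).
  apply: measurable_to_XX => i; rewrite /mix; case: (i \in d).
    exact: measurable_coordX.
  exact: measurable_cst.
pose u (a d : {set 'I_n}) (z : XA X a) := mix X d (extend X a y z) y.
have mu_ a d : measurable_fun setT (u a d).
  exact: measurableT_comp (mmix d) (measurable_extend X a y).
have uPr (a d : {set 'I_n}) x : d \subset a -> u a d (Pr X a x) = mix X d x y.
  by move=> da; rewrite /u extendE mix_mix.
have mSu a d : measurable_fun setT (S \o u a d) by exact: measurableT_comp.
have ISu (a d : {set 'I_n}) : #|a| = k -> d \subset a ->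
    (\int[mu a]_z (S \o u a d) z < +oo)%E.
  move=> ak da; rewrite (ge0_integral_Pr mu pi pi_mu)//=; last exact: mSu.
  under eq_integral do rewrite /comp uPr//.
  apply: (unif_equiv_integral_lty pi P (fun x => S (mix X d x y)) piP _ _).2 => //.
  exact: (measurableT_comp mS (mmix d)).
pose subs (a : {set 'I_n}) := seq.filter (fun d : {set 'I_n} => d \subset a)
  (index_enum _).
(* The terms are nonnegative, so [Y a] consists of the points where [S] is infinite along some
   [u a d] with [d \subset a]. *)
pose Y (a : {set 'I_n}) : set (XA X a) :=
  [set z | (\sum_(d <- subs a) (S \o u a d) z = +oo)%E].
(* Every [b] is charged to [alpha b]. As [d \subset b \subset alpha b], the point [mix d x y]
   depends on [x] only through its [alpha b]-coordinates, and [u] recovers it from them. *)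
pose h (a : {set 'I_n}) (z : XA X a) : R :=
  \sum_(b : {set 'I_n} | (#|b| <= k)%N && (alpha b == a)) (-1) ^+ #|b| *
    \sum_(d : {set 'I_n} | d \subset b) (-1) ^+ #|d| * L (u a d z).
exists h, Y; split.
- move=> a ak.
  have hE : EFin \o h a = (fun z =>
      \sum_(b <- index_enum {set 'I_n} | (#|b| <= k)%N && (alpha b == a))
        ((-1) ^+ #|b|)%:E *
        \sum_(d <- index_enum {set 'I_n} | d \subset b)
          ((-1) ^+ #|d|)%:E * (L (u a d z))%:E)%E.
    apply/funext => z; rewrite /h /= -sumEFin; apply: eq_bigr => b _.
    by rewrite EFinM -sumEFin.
  rewrite hE; apply: integrable_sum => // b /andP[bk /eqP ba].
  apply: integrableZl => //; apply: integrable_sum => // d db.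
  apply: integrableZl => //.
  have da : d \subset a.
    by apply: fintype.subset_trans db _; rewrite -ba; have [] := alphaP b bk.
  apply/integrableP; split.
    by apply/measurable_EFinP; exact: (measurableT_comp mL (mu_ a d)).
  apply: le_lt_trans (ISu a d ak da).
  apply: ge0_le_integral => //.
    apply: measurableT_comp => //; apply/measurable_EFinP.
    exact: (measurableT_comp mL (mu_ a d)).
  by move=> z _; exact: LS.
- move=> a ak.
  pose Sa (z : XA X a) := (\sum_(d <- subs a) (S \o u a d) z)%E.
  have Sa0 z : (0 <= Sa z)%E by apply: sume_ge0 => d _; exact: S0.
  have mSa : measurable_fun setT Sa by exact: emeasurable_sum.
  have ISa : (mu a).-integrable setT Sa.
    apply/integrableP; split => //.
    under eq_integral do rewrite gee0_abs//.
    rewrite /Sa ge0_integral_sum//; last by move=> d z _; exact: S0.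
    by rewrite big_filter; apply: lte_sum_pinfty => d da; exact: ISu.
  have mY : measurable (Y a).
    rewrite (_ : Y a = setT `&` Sa @^-1` [set +oo%E]); last by rewrite setTI.
    by apply: mSa => //; exact: emeasurable_set1.
  split => //; apply: (measure_negligible mY).
  apply: negligibleS (integrable_ae measurableT ISa) => z /= Sz /(_ Logic.I).
  by rewrite /Sa Sz.
- move=> x Yx.
  have Sx (a d : {set 'I_n}) : #|a| = k -> d \subset a -> (S (mix X d x y) < +oo)%E.
    move=> ak da; rewrite -(uPr a)//.
    have := Yx a ak; rewrite /Y/= => /eqP; rewrite -ltey; apply: le_lt_trans.
    by rewrite big_filter (bigD1 d)//= leeDl// sume_ge0// => e _; exact: S0.
  have -> : sum_Pr (k := k) h x =
      \sum_(b : {set 'I_n} | (#|b| <= k)%N) (-1) ^+ #|b| *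
        \sum_(d : {set 'I_n} | d \subset b) (-1) ^+ #|d| * L (mix X d x y).
    rewrite (partition_big alpha (fun a => #|a| == k))/=; last first.
      by move=> b /alphaP[_ ->].
    apply: eq_bigr => a /eqP ak; apply: eq_bigr => b /andP[bk /eqP ba].
    congr (_ * _); apply: eq_bigr => d db; rewrite uPr//.
    by apply: fintype.subset_trans db _; rewrite -ba; have [] := alphaP b bk.
  (* The identity is exact for each [g j], so only finitely many terms have to converge. *)
  have -> : (fun j => sum_Pr (k := k) (g j) x) = (fun j =>
      \sum_(b : {set 'I_n} | (#|b| <= k)%N) (-1) ^+ #|b| *
        \sum_(d : {set 'I_n} | d \subset b) (-1) ^+ #|d| *
          sum_Pr (k := k) (g j) (mix X d x y)).
    by apply/funext => j; rewrite /sum_Pr mix_inclusion_exclusion.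
  apply: cvg_big => [|b bk]; first exact: add_continuous.
  have c1 : (fun=> (-1) ^+ #|b| : R) @ \oo --> ((-1) ^+ #|b| : R) by exact: cvg_cst.
  apply: (cvgM c1); apply: cvg_big => [|d db]; first exact: add_continuous.
  have c2 : (fun=> (-1) ^+ #|d| : R) @ \oo --> ((-1) ^+ #|d| : R) by exact: cvg_cst.
  apply: (cvgM c2); apply: gL.
  have [ba ak] := alphaP b bk.
  by apply: (Sx (alpha b)) => //; exact: fintype.subset_trans db ba.
Qed.

End components.

(** * Finiteness and attainment of the dual supremum *)

Lemma ae_le0_Rintegral {d} {T : measurableType d} {R : realType}
    (P : {measure set T -> \bar R}) (F : T -> R) :
  P.-integrable setT (EFin \o F) -> {ae P, forall x, F x <= 0} ->
  \int[P]_x F x <= 0.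
Proof.
move=> iF F0; have mF : measurable_fun setT F.
  by case/integrableP : iF => /measurable_EFinP.
rewrite /Rintegral -lee_fin fineK; last exact: integrable_fin_num.
rewrite (ae_eq_integral (fun x => - `|F x|%:E)%E)//.
- by rewrite integral_ge0N//= leeNl oppe0; apply: integral_ge0.
- exact/measurable_EFinP.
- by apply/measurable_EFinP; apply: measurable_funN; exact: measurableT_comp.
- by apply: filterS F0 => x Fx _ /=; rewrite ler0_norm// opprK.
Qed.

Section dual_attainment.
Context {R : realType} {n k : nat} {X : 'I_n -> ptopologicalType}.
Variable mu : forall a : {set 'I_n}, probability (XA X a) R.
Variables (c : XX X -> \bar R) (ca : forall a : {set 'I_n}, XA X a -> \bar R).
Hypothesis hca : forall a : {set 'I_n}, #|a| = k ->
  (mu a).-integrable setT (ca a) /\ (forall y, ca a y != -oo%E).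
Hypothesis hbound : forall x : XX X,
  (`|c x| <= \sum_(a : {set 'I_n} | #|a| == k) ca a (Pr X a x))%E.

(** [fine] sends [+oo] to 0; the points of the product space where this alters a bound lie in [bad],
    a set of zero thickness. *)
Let cr (a : {set 'I_n}) (z : XA X a) : R := fine (ca a z).

Let integrable_cr (a : {set 'I_n}) : #|a| = k ->
  (mu a).-integrable setT (EFin \o cr a).
Proof.
move=> ak; have [ica _] := hca a ak; apply: (le_integrable measurableT _ _ ica) => //.
  apply/measurable_EFinP; apply: measurableT_comp => //.
  by case/integrableP : ica.
by move=> z _; rewrite /= /cr; case: (ca a z) => [r| |]/=; rewrite ?normr0 ?leey.
Qed.

Let bad : set (XX X) := \bigcup_(a in [set a : {set 'I_n} | #|a| = k])
  (Pr X a @^-1` [set z | ca a z = +oo%E]).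

Let zero_thick_bad : zero_thick R n k X mu bad.
Proof.
apply: (zero_thick_Pr mu (fun a => [set z | ca a z = +oo%E])) => a ak.
have [ica _] := hca a ak.
have mY : measurable [set z | ca a z = +oo%E].
  rewrite -[X in measurable X]setTI; case/integrableP : ica => + _.
  by move=> /(_ measurableT [set +oo%E]); apply; exact: emeasurable_set1.
split => //; apply: (measure_negligible mY).
by apply: negligibleS (integrable_ae measurableT ica) => z /= -> /(_ Logic.I).
Qed.

Let bound x : ~ bad x ->
  ((- sum_Pr (k := k) cr x)%:E <= c x <= (sum_Pr (k := k) cr x)%:E)%E.
Proof.
move=> nx; have : (`|c x| <= (sum_Pr (k := k) cr x)%:E)%E.
  apply: le_trans (hbound x) _; rewrite -sumEFin; apply: lee_sum => a /eqP ak.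
  have [_ /(_ (Pr X a x))] := hca a ak; rewrite /cr.
  by case E : (ca a (Pr X a x)) => [r| |]//= _; exfalso; apply: nx; exists a.
move=> cC; apply/andP; split; last exact: le_trans (lee_abs _) cC.
by rewrite EFinN leeNl; apply: le_trans cC; rewrite -abseN lee_abs.
Qed.

(** Admissibility is the lower half of [bound]; it keeps the supremum above [-oo]. *)
Lemma Psi_opp_bound : Psi R n k X mu c (fun a z => - cr a z).
Proof.
split=> [a ak|].
  have iN : (mu a).-integrable setT (EFin \o (fun z => - cr a z)).
    by apply: eq_integrable (integrableN (integrable_cr a ak)).
  by split => //; case/integrableP : iN => /measurable_EFinP.
exists bad; split => // x /bound/andP[+ _]; rewrite /sum_Pr.
by rewrite sumrN.
Qed.

(** Centering makes the sums nonpositive almost everywhere, as the exponential minimization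
    requires. *)
Let centered (f : forall a : {set 'I_n}, XA X a -> R) (a : {set 'I_n}) z :=
  f a z - cr a z.

Let sum_Pr_centered f x :
  sum_Pr (k := k) (centered f) x = sum_Pr (k := k) f x - sum_Pr (k := k) cr x.
Proof. by rewrite /sum_Pr sumrB. Qed.

Let integrable_centered f : Psi R n k X mu c f ->
  forall a : {set 'I_n}, #|a| = k -> (mu a).-integrable setT (EFin \o centered f a).
Proof.
move=> [fi _] a ak; have [_ fia] := fi a ak.
by apply: eq_integrable (integrableB measurableT fia (integrable_cr a ak)).
Qed.

Lemma Psi_mid f g : Psi R n k X mu c f -> Psi R n k X mu c g ->
  Psi R n k X mu c (fun a z => (f a z + g a z) / 2).
Proof.
move=> [fi [A [A0 fA]]] [gi [B [B0 gB]]]; split=> [a ak|].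
  have [_ fa] := fi a ak; have [_ ga] := gi a ak.
  have im : (mu a).-integrable setT (EFin \o (fun z => (f a z + g a z) / 2)).
    by apply: eq_integrable (integrableZr measurableT 2^-1
      (integrableD measurableT fa ga)).
  by split => //; case/integrableP : im => /measurable_EFinP.
exists (A `|` B); split; first exact: zero_thickU.
move=> x /not_orP[/fA fx /gB gx].
rewrite -mulr_suml big_split/=; set s := \sum_(_ | _) _; set t := \sum_(_ | _) _.
(* The midpoint is at most the larger of [s] and [t], which avoids arithmetic with the possibly
   infinite [c x]. *)
have [st|ts] := leP s t.
  by apply: le_trans gx; rewrite lee_fin; rewrite -/s -/t; lra.
by apply: le_trans fx; rewrite lee_fin; rewrite -/s -/t; lra.
Qed.

Section reference_measure.
Variable pi : probability (XX X) R.
Hypothesis pi_mu : forall a : {set 'I_n}, #|a| = k ->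
  forall A, measurable A -> pi (Pr X a @^-1` A) = mu a A.

Lemma Psi_ae_le_bound f : Psi R n k X mu c f ->
  {ae pi, forall x, sum_Pr (k := k) (centered f) x <= 0}.
Proof.
move=> [_ [A [A0 fA]]].
have := zero_thick_ae mu pi pi_mu _ (zero_thickU mu _ _ A0 zero_thick_bad).
apply: filterS => x /not_orP[/fA fx /bound/andP[_ xC]].
by rewrite sum_Pr_centered subr_le0 -lee_fin; exact: le_trans fx xC.
Qed.

Lemma Rintegral_centered f : Psi R n k X mu c f ->
  \int[pi]_x sum_Pr (k := k) (centered f) x =
  \int[pi]_x sum_Pr (k := k) f x - \int[pi]_x sum_Pr (k := k) cr x.
Proof.
move=> [fi _]; under eq_Rintegral do rewrite sum_Pr_centered.
rewrite RintegralB//; apply: (integrable_sum_Pr mu pi pi_mu) => // a ak.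
by have [] := fi a ak.
Qed.

Lemma dual_value_fin f : Psi R n k X mu c f ->
  dual_value R n k X mu f = (\int[pi]_x sum_Pr (k := k) f x)%:E.
Proof.
by move=> [fi _]; apply: (dual_valueE mu pi pi_mu) => a ak; have [] := fi a ak.
Qed.

(** The tuple [- cr] bounds the supremum from below. The integral of [sum_Pr cr] bounds it from
    above, because centered sums have nonpositive integral. *)
Lemma Jval_fin_num : Jval R n k X mu c \is a fin_num.
Proof.
rewrite fin_real//; apply/andP; split.
  apply: (@lt_le_trans _ _ (dual_value R n k X mu (fun a z => - cr a z))).
    by rewrite (dual_value_fin _ Psi_opp_bound) ltNyr.
  apply: ereal_sup_ubound; exists (fun a z => - cr a z); split => //.
  exact: Psi_opp_bound.
apply: (@le_lt_trans _ _ (\int[pi]_x sum_Pr (k := k) cr x)%:E); last exact: ltry.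
apply: ge_ereal_sup => _ [f [fP ->]]; rewrite (dual_value_fin _ fP) lee_fin.
rewrite -subr_le0 -Rintegral_centered//; apply: ae_le0_Rintegral.
  by apply: (integrable_sum_Pr mu pi pi_mu); exact: integrable_centered.
exact: Psi_ae_le_bound.
Qed.

Lemma exists_Psi_attaining (nu : forall i, probability (borelX X i) R)
    (P : probability (XX X) R) : (k <= n)%N ->
  is_product_measure R n X nu P -> unif_equiv R n X pi P ->
  exists f, Psi R n k X mu c f /\ dual_value R n k X mu f = Jval R n k X mu c.
Proof.
move=> kn Pnu piP.
pose IC := \int[pi]_x sum_Pr (k := k) cr x.
pose J := fine (Jval R n k X mu c).
have JE : Jval R n k X mu c = J%:E by rewrite fineK//; exact: Jval_fin_num.
(* Centering shifts every dual value by [IC], so the level to be reached by the integrals over [K]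
   is [J - IC]. *)
pose K := [set F : XX X -> R |
  exists f, Psi R n k X mu c f /\ F = sum_Pr (k := k) (centered f)].
have KI F : K F -> pi.-integrable setT (EFin \o F).
  move=> [f [fP ->]]; apply: (integrable_sum_Pr mu pi pi_mu).
  exact: integrable_centered.
have K0 F : K F -> {ae pi, forall x, F x <= 0}.
  by move=> [f [fP ->]]; exact: Psi_ae_le_bound.
have Kmid F G : K F -> K G -> K (fun x => (F x + G x) / 2).
  move=> [f [fP ->]] [g [gP ->]]; exists (fun a z => (f a z + g a z) / 2).
  split; first exact: Psi_mid.
  apply/funext => x; rewrite !sum_Pr_centered /sum_Pr -mulr_suml big_split/=.
  lra.
have KJ e : 0 < e -> exists2 F, K F & (J - IC) - e < \int[pi]_x F x.
  move=> e0; have [_ [f [fP ->]]] := ub_ereal_sup_adherent e0 Jval_fin_num.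
  rewrite -/(Jval R n k X mu c) JE (dual_value_fin _ fP) -EFinB lte_fin => fJ.
  exists (sum_Pr (k := k) (centered f)); first by exists f.
  by rewrite Rintegral_centered// -/IC; lra.
have [G [S [L [KG [mS S0 IS] [mL LS] GL JL]]]] :=
  exists_cvg_maximizing_sequence pi K (J - IC) KI K0 Kmid KJ.
have /choice[f fP] := KG.
have fG j : sum_Pr (k := k) (centered (f j)) = G j by have [_ ->] := fP j.
have [|h [Y [hi Y0 hY]]] := exists_cvg_components mu pi P nu pi_mu Pnu piP kn
  (fun j => centered (f j)) S L mS S0 IS mL LS.
  by move=> x Sx; under eq_fun do rewrite fG; exact: GL.
(* Almost everywhere both integrands are the limit of the same sequence [G j x]: the left one off
   the cylinders over [Y], the right one where [S] is finite. *)
have hC : \int[pi]_x sum_Pr (k := k) h x = \int[pi]_x L x.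
  have Sae : {ae pi, forall x, (S x < +oo)%E}.
    have iS : pi.-integrable setT S.
      apply/integrableP; split => //.
      by under eq_integral do rewrite gee0_abs//.
    apply: filterS (integrable_ae measurableT iS) => x /(_ Logic.I).
    by rewrite ge0_fin_numE.
  rewrite /Rintegral; congr fine; apply: ae_eq_integral => //.
  - by case/integrableP : (integrable_sum_Pr mu pi pi_mu h hi).
  - exact/measurable_EFinP.
  have Yae := zero_thick_ae mu pi pi_mu _ (zero_thick_Pr mu Y Y0).
  apply: filterS2 Sae Yae => x Sx nY _.
  have hx := hY x (fun a ak Yx => nY (ex_intro2 _ _ a ak Yx)).
  have Lx := GL x Sx; congr EFin.
  rewrite -(cvg_lim _ hx)// -(cvg_lim _ Lx)//.
  by under eq_fun do rewrite fG.
pose F (a : {set 'I_n}) (z : XA X a) := h a z + cr a z.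
have sum_F x : sum_Pr (k := k) F x = sum_Pr (k := k) h x + sum_Pr (k := k) cr x.
  by rewrite /sum_Pr big_split.
have Fi (a : {set 'I_n}) : #|a| = k -> (mu a).-integrable setT (EFin \o F a).
  move=> ak.
  by apply: eq_integrable (integrableD measurableT (hi a ak) (integrable_cr a ak)).
have FPsi : Psi R n k X mu c F.
  split=> [a ak|].
    by split; [case/integrableP : (Fi a ak) => /measurable_EFinP|exact: Fi].
  have /choice[A AP] := fun j => (fP j).1.2.
  exists ((\bigcup_j A j) `|` (\bigcup_(a in [set a : {set 'I_n} | #|a| = k])
    (Pr X a @^-1` Y a))); split.
    apply: zero_thickU; last exact: zero_thick_Pr.
    by apply: zero_thick_bigcup => j; have [] := AP j.
  move=> x /not_orP[nA nY]; rewrite -/(sum_Pr (k := k) F x).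
  have fc j : ((sum_Pr (k := k) (f j) x)%:E <= c x)%E.
    by apply: (AP j).2 => Ax; apply: nA; exists j.
  have cvgF : (fun j => sum_Pr (k := k) (f j) x) @ \oo --> sum_Pr (k := k) F x.
    have hx := hY x (fun a ak Yx => nY (ex_intro2 _ _ a ak Yx)).
    have cc : (fun _ : nat => sum_Pr (k := k) cr x) @ \oo --> sum_Pr (k := k) cr x.
      exact: cvg_cst.
    rewrite sum_F; apply: cvg_trans (cvgD hx cc).
    by apply: near_eq_cvg; apply: nearW => j /=; rewrite fctE sum_Pr_centered subrK.
  (* For real [c x] the inequality passes to the limit; [+oo] is trivial, and [-oo] is excluded by
     the inequality at index 0. *)
  case: (c x) fc => [r fc| |]; last 2 first.
  - by move=> _; exact: leey.
  - by move=> /(_ 0%N).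
  rewrite lee_fin -(cvg_lim _ cvgF)//; apply: limr_le.
    by apply/cvg_ex; eexists; exact: cvgF.
  by apply: nearW => j; rewrite -lee_fin.
exists F; split => //; apply/eqP; rewrite eq_le; apply/andP; split.
  by apply: ereal_sup_ubound; exists F.
(* [JL] gives [J - IC <= \int L = \int h]; adding [IC] back yields the missing inequality
   [J <= \int F]. *)
rewrite JE (dual_value_fin _ FPsi) lee_fin.
have -> : \int[pi]_x sum_Pr (k := k) F x =
    \int[pi]_x sum_Pr (k := k) h x + IC.
  under eq_Rintegral do rewrite sum_F.
  rewrite RintegralD//; apply: (integrable_sum_Pr mu pi pi_mu) => //.
rewrite hC; lra.
Qed.

End reference_measure.

End dual_attainment.

Theorem mainTheorem12 (R : realType) (n k : nat) (X : 'I_n -> ptopologicalType)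
  (hpolish : forall i, polish R (X i))
  (hk1 : (1 <= k)%N) (hkn : (k < n)%N)
  (mu : forall a : {set 'I_n}, probability (XA X a) R)
  (hred : reducible R n k X mu)
  (c : XX X -> \bar R) (hc : measurable_fun setT c)
  (ca : forall a : {set 'I_n}, XA X a -> \bar R)
  (hca : forall a : {set 'I_n}, #|a| = k ->
     (mu a).-integrable setT (ca a) /\ (forall y, ca a y != -oo%E))
  (hbound : forall x : XX X,
     (`|c x| <= \sum_(a : {set 'I_n} | #|a| == k) ca a (Pr X a x))%E) :
  Jval R n k X mu c \is a fin_num /\
  exists f, Psi R n k X mu c f /\ dual_value R n k X mu f = Jval R n k X mu c.
Proof.
have [pi [pi_mu [nu [P [Pnu piP]]]]] := hred.
split; first exact: (Jval_fin_num mu c ca hca hbound pi pi_mu).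
exact: (exists_Psi_attaining mu c ca hca hbound pi pi_mu nu P (ltnW hkn)).
Qed.
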